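(* Let $\Gamma$ be a free group of rank $r\geq 1$ acting by measure-preserving transformations on an atomless probability space $(X,\nu)$. Let $\{a_1,\dots,a_r\}$ be a free generating set of $\Gamma$, let $S=\{a_1^{\pm 1},\dots,a_r^{\pm 1}\}$ and let $q=2r-1$. For every integer $n\ge 0$, let $S_n$, respectively $B_n$, be the sphere, respectively the ball, of $\Gamma$ around the identity $e\in\Gamma$ of radius $n$ with respect to the word metric defined by $S$. Then \[ \sup_{\|f\|_2=1}\left\|x\mapsto\frac{1}{|S_n|}\sum_{\gamma\in S_n}f(\gamma x)-\int_Xf(y)\,d\nu(y)\right\|_2\geq\left(1+\frac{q-1}{q+1}n\right)q^{-n/2}, \] and \[ \sup_{\|f\|_2=1}\left\|x\mapsto\frac{1}{|B_n|}\sum_{\gamma\in B_n}f(\gamma x)-\int_Xf(y)\,d\nu(y)\right\|_2\geq c(q,n)\left(1+\left(1+\frac{1}{\sqrt q}\right)n\right)q^{-n/2}, \] where $c(q,n)=\left(1+2q^{-n}\sum_{k=0}^{n-1}q^k\right)^{-1}$. In both formulas the supremum is over all $f\in L^2(X,\nu)$ (complex-valued) with $\|f\|_2=1$.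
   Context: A measure-preserving transformation of $(X,\nu)$ is represented by a bijection $g:X\to X$ with $\nu(g^{-1}B)=\nu(B)$ for every $B$ in the $\sigma$-algebra on which $\nu$ is defined; two such transformations are identified if they coincide on a set of full measure. The word length of $\gamma\in\Gamma$ is the smallest $k$ such that $\gamma$ is a product of $k$ elements of $S$; $S_n$ is the set of elements of word length exactly $n$, and $B_n$ the set of elements of word length at most $n$. $\|\cdot\|_2$ is the $L^2(X,\nu)$-norm. For $n=0$ the empty sum $\sum_{k=0}^{n-1}q^k$ equals $0$. *)

(* Defs.v *)
From HB Require Import structures.
From mathcomp Require Import all_boot all_order all_algebra.
From mathcomp Require Import all_classical all_reals all_analysis.
From mathcomp Require Import finmap complex.

Set Implicit Arguments.
Unset Strict Implicit.
Unset Printing Implicit Defensive.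

Import Order.TTheory GRing.Theory Num.Theory.
Import numFieldNormedType.Exports.

Local Open Scope classical_set_scope.
Local Open Scope ring_scope.

Section FreeGroup.
Context (G : groupType) (r : nat) (a : 'I_r -> G).

(* A word is a sequence of letters; [(i, false)] stands for [a i] and
   [(i, true)] for its inverse. *)
Definition letter_val (l : 'I_r * bool) : G :=
  if l.2 then ((a l.1)^-1)%g else a l.1.

Definition word_val (w : seq ('I_r * bool)) : G :=
  (\big[*%g/1]_(l <- w) letter_val l)%g.

Definition reduced (w : seq ('I_r * bool)) : bool :=
  sorted [rel l m : 'I_r * bool | (l.1 == m.1) ==> (l.2 == m.2)] w.

Definition free_generators : Prop :=
  forall g : G, exists! w, reduced w /\ word_val w = g.

Definition sym_generators : set G :=
  [set s | exists i, s = a i \/ s = ((a i)^-1)%g].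

End FreeGroup.

Section WordMetric.
Context (G : groupType) (S : set G).

Definition is_product_of (k : nat) (g : G) : Prop :=
  exists w : seq G,
    [/\ size w = k, forall s, s \in w -> S s & (\big[*%g/1]_(s <- w) s)%g = g].

(* Relational, so that it makes sense when S does not generate G. *)
Definition has_word_length (g : G) (k : nat) : Prop :=
  is_product_of k g /\ forall j, is_product_of j g -> (k <= j)%N.

Definition word_sphere (n : nat) : set G := [set g | has_word_length g n].

Definition word_ball (n : nat) : set G :=
  [set g | exists2 k, (k <= n)%N & has_word_length g k].

End WordMetric.

Section MeasurePreserving.
Context (d : measure_display) (X : measurableType d) (R : realType).
Context (nu : probability X R).

Definition atomless : Prop :=
  forall A : set X, measurable A -> (0 < nu A)%E ->
    exists B : set X, [/\ measurable B, B `<=` A & (0 < nu B < nu A)%E].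

Definition measure_preserving (g : X -> X) : Prop :=
  [/\ bijective g, measurable_fun setT g &
      forall B : set X, measurable B -> nu (g @^-1` B) = nu B].

(* The group laws hold only almost everywhere, since transformations that
   coincide on a set of full measure are identified. *)
Definition mp_action (G : groupType) (T : G -> X -> X) : Prop :=
  [/\ (forall g, measure_preserving (T g)),
      (\forall x \ae nu, T 1%g x = x) &
      forall g h, \forall x \ae nu, T (g * h)%g x = T g (T h x)].

Definition L2norm (f : X -> R[i]) : \bar R :=
  'N[nu]_2%:E[(fun x => (ComplexField.Normc.normc (f x))%:E)].

Definition in_L2 (f : X -> R[i]) : Prop :=
  [/\ measurable_fun setT (fun x => complex.Re (f x)),
      measurable_fun setT (fun x => complex.Im (f x)) &
      (L2norm f < +oo)%E].

Definition Cintegral (f : X -> R[i]) : R[i] :=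
  Complex (\int[nu]_x complex.Re (f x)) (\int[nu]_x complex.Im (f x)).

(* Meaningful for finite A only. *)
Definition average (G : groupType) (T : G -> X -> X) (A : set G)
    (f : X -> R[i]) (x : X) : R[i] :=
  (#|` fset_set A |%fset)%:R^-1 * \sum_(g \in A) f (T g x).

Definition sup_deviation (G : groupType) (T : G -> X -> X) (A : set G)
    : \bar R :=
  ereal_sup [set L2norm (fun x => average T A f x - Cintegral f)
            | f in [set f | in_L2 f /\ L2norm f = 1%E]].

End MeasurePreserving.

(* Main.v *)
Require Import Defs.
From mathcomp Require Import all_boot all_order all_algebra.
From mathcomp Require Import all_classical all_reals all_analysis.
From mathcomp Require Import measurable_realfun finmap complex.
From mathcomp Require Import zify ring lra.

Import Order.TTheory GRing.Theory Num.Theory.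
Local Open Scope classical_set_scope.
Local Open Scope ring_scope.

Set Implicit Arguments.
Unset Strict Implicit.
Unset Printing Implicit Defensive.

(** The norm of [f |-> (average of f) - (integral of f)] is bounded below by that
    of the averaging operator on functions on [G] itself, and a lower bound for
    the latter comes from positive test functions on the Cayley tree.

    Transplantation.  Let [V] be a finite set of [G], and let [f >= 0] be a
    finitely supported function on [G] such that
    [\sum_(v in V) f (g v^-1) >= lam * f g] for every [g].  For a set [A] of
    small measure [t > 0] put [h x = \sum_g f g * 1_A (g x)].  The average [P h]
    of [h] over [V] satisfies [P h >= (lam / |V|) h] almost everywhere, because
    [P h] is again such a sum, with [f] replaced by its average.  The square of
    the L2 norm of [h] is at least a constant times [t], while the square of
    its integral is of order [t ^ 2]; so the mean is negligible as [t] tends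
    to 0 and the deviation has norm at least [lam / |V|]
    ([sup_deviation_ge]).  Since all terms are nonnegative, coincidences
    between translates of [A] can only increase these norms.  Small sets exist because the space is atomless
    ([atomless_small]).

    The test function.  Write [s] for the square root of [q] and [|g|] for the
    length of the reduced word of [g].  At the points with [|g| >= k >= 1], the
    function [s ^- |g|] satisfies the eigenfunction equation for the sum over
    the sphere of radius [k], with eigenvalue
    [sphere_eigenvalue k = s ^ k (2 + (k - 1) (q - 1) / q)], the number of
    points of the sphere times the value at distance [k] of the spherical
    function at the edge of the spectrum.  Multiply it by a tent function of
    [|g|], which rises with slope 1 from 0 at the root to [L] and falls back to
    0 at [2 L].  Near the root the odd extension of the tent makes the
    inequality hold for free; at the top the loss is a factor [1 - k / L]
    ([sum_tent_radial_rwords_ge]).  Letting [L] tend to infinity gives the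
    bound for the sphere; the bound for the ball follows from the same test
    function, by summing the eigenvalues over the radii up to [n]
    ([sum_sphere_eigenvalue]). *)

Lemma eq_implies_le (disp : Order.disp_t) (P : porderType disp) (x y : P) :
  x = y -> (x <= y)%O.
Proof. by move=> ->. Qed.

(** * Reduced words and distances in the Cayley tree *)

Section Words.
Context (r : nat).
Notation letter := ('I_r * bool)%type.
Implicit Types (l x y z : letter) (p v w : seq letter).

(** The relation between consecutive letters of a reduced word, given a name so
    that it can be used in [path]. *)
Definition fits : rel letter := [rel l m | (l.1 == m.1) ==> (l.2 == m.2)].

Definition linv l : letter := (l.1, ~~ l.2).

Lemma fitsE x y : fits x y = (y != linv x).
Proof.
case: x y => [i b] [j c]; rewrite /fits /= xpair_eqE eq_sym.
by case: eqP => //=; case: b c => [] [].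
Qed.

Lemma fits_sym : symmetric fits.
Proof. by move=> x y; rewrite /fits /= eq_sym [x.2 == _]eq_sym. Qed.

Lemma linvK : involutive linv.
Proof. by case=> i b; rewrite /linv /= negbK. Qed.

(** The distance between the endpoints of two reduced words read from the root
    of the tree: their common beginning is stripped. *)
Fixpoint dist v w : nat :=
  match v, w with
  | x :: v', y :: w' => if x == y then dist v' w' else (size v' + size w').+2
  | _, _ => (size v + size w)%N
  end.

Lemma dist_nil v : dist [::] v = size v.
Proof. by case: v. Qed.

Lemma dist_nilr v : dist v [::] = size v.
Proof. by case: v => //= x v; rewrite addn0. Qed.

Fixpoint words (k : nat) : seq (seq letter) :=
  if k is k'.+1 then
    [seq x :: p | x <- enum [set: letter]%SET, p <- words k']
  else [:: [::]].

Lemma mem_words k p : (p \in words k) = (size p == k).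
Proof.
elim: k p => [|k IH] p; first by rewrite inE size_eq0.
apply/allpairsP/idP => [[[x v] /= [_ ]]|]; first by rewrite IH => /eqP <- ->.
case: p => [//|x p]; rewrite /= eqSS => pk; exists (x, p); split => //=.
  by rewrite mem_enum inE.
by rewrite IH.
Qed.

Lemma words_uniq k : uniq (words k).
Proof.
elim: k => [//|k IH] /=; apply: allpairs_uniq => //; first exact: enum_uniq.
by move=> [x p] [y v] _ _ /= [-> ->].
Qed.

Definition rwords k := [seq p <- words k | sorted fits p].

Lemma mem_rwords k p : (p \in rwords k) = sorted fits p && (size p == k).
Proof. by rewrite mem_filter mem_words. Qed.

Definition rwords_le n := flatten [seq rwords k | k <- iota 0 n.+1].

Lemma mem_rwords_le n p : (p \in rwords_le n) = sorted fits p && (size p <= n)%N.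
Proof.
apply/flatten_mapP/andP => [[k]|[rp pn]].
  by rewrite mem_iota add0n ltnS mem_rwords => /= kn /andP[-> /eqP ->].
by exists (size p); rewrite ?mem_iota// mem_rwords rp eqxx.
Qed.

Lemma rwords_le_uniq n : uniq (rwords_le n).
Proof.
have sh k p : p \in rwords k -> size p = k by rewrite mem_rwords => /andP[_ /eqP].
rewrite /rwords_le; elim: (iota 0 n.+1) (iota_uniq 0 n.+1) => [//|k s IH] /= /andP[ks us].
rewrite cat_uniq IH// filter_uniq ?words_uniq// andbT /=.
apply/hasPn => p /flatten_mapP[j js pj]; apply/negP => pk.
by move: ks; rewrite -(sh _ _ pk) (sh _ _ pj) js.
Qed.

End Words.

(** * Normal forms and word length *)

Section NormalForm.
Context (G : groupType) (r : nat) (a : 'I_r -> G).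
Notation letter := ('I_r * bool)%type.
Implicit Types (l x y z : letter) (p v w : seq letter) (g h : G).

(** Words are stored from the last letter to the first.  The quotient
    [rval w * (rval v)^-1] then cancels the common beginning of [w] and [v],
    which is what structural recursion on lists reaches. *)
Definition rval p : G := word_val a (rev p).

Lemma rval_cons x p : rval (x :: p) = (rval p * letter_val a x)%g.
Proof. by rewrite /rval /word_val rev_cons -cats1 big_cat big_seq1. Qed.

Lemma rval_nil : rval [::] = 1%g.
Proof. by rewrite /rval /word_val big_nil. Qed.

Lemma letter_val_linv x : letter_val a (linv x) = ((letter_val a x)^-1)%g.
Proof. by case: x => i []; rewrite /letter_val /= ?invgK. Qed.

(** [catrev (map linv v) w] spells [w] followed by the inverse of [v]; it is
    reduced unless the letters at the junction cancel. *)
Lemma reduced_glue v w : sorted (@fits r) v -> sorted (@fits r) w ->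
  (if (v, w) is (x :: _, y :: _) then x != y else true) ->
  sorted (@fits r) (catrev (map (@linv r) v) w).
Proof.
elim: v w => [//|z v IH] w /= rv rw vw; apply: IH.
- exact: path_sorted rv.
- by case: w rw vw => [//|x w] /= -> /=; rewrite fitsE linvK eq_sym => ->.
- by case: v rv => [//|y v] /= /andP[]; rewrite fitsE.
Qed.

Lemma rval_glue v w :
  rval (catrev (map (@linv r) v) w) = (rval w * (rval v)^-1)%g.
Proof.
elim: v w => [|z v IH] w /=; first by rewrite rval_nil invg1 mulg1.
by rewrite IH !rval_cons letter_val_linv invgM mulgA.
Qed.

Lemma rval_quotient w v : sorted (@fits r) w -> sorted (@fits r) v ->
  exists p, [/\ sorted (@fits r) p, rval p = (rval w * (rval v)^-1)%g &
    size p = dist w v].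
Proof.
have glue w' v' : sorted (@fits r) w' -> sorted (@fits r) v' ->
    (if (v', w') is (x :: _, y :: _) then x != y else true) ->
    exists p, [/\ sorted (@fits r) p, rval p = (rval w' * (rval v')^-1)%g &
      size p = (size w' + size v')%N].
  move=> rw rv vw; exists (catrev (map (@linv r) v') w'); split.
  - exact: reduced_glue.
  - exact: rval_glue.
  - by rewrite catrevE size_cat size_rev size_map addnC.
elim: w v => [|x w IH] [|y v] rw rv; try exact: glue.
rewrite [dist _ _]/=; case: eqP => [<-|/eqP xy]; last first.
  have [|p [rp pE sp]] := glue _ _ rw rv; first by rewrite /= eq_sym.
  by exists p; rewrite sp /= addSn addnS.
have [p [rp pE sp]] := IH v (path_sorted rw) (path_sorted rv).
by exists p; split=> //; rewrite pE !rval_cons invgM mulgA mulgK.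
Qed.

Hypothesis free_a : free_generators a.

Lemma normal_form_subproof g : exists p, sorted (@fits r) p /\ rval p = g.
Proof.
have [w [[rw wg] _]] := free_a g; exists (rev w); split.
  by rewrite rev_sorted; apply: sub_sorted rw => x y; rewrite fits_sym.
by rewrite /rval revK.
Qed.

Definition normal_form g : seq letter := projT1 (cid (normal_form_subproof g)).

Lemma normal_form_reduced g : sorted (@fits r) (normal_form g).
Proof. by rewrite /normal_form; case: cid => p []. Qed.

Lemma rval_normal_form g : rval (normal_form g) = g.
Proof. by rewrite /normal_form; case: cid => p []. Qed.

Lemma rval_inj p v : sorted (@fits r) p -> sorted (@fits r) v ->
  rval p = rval v -> p = v.
Proof.
have rs w : sorted (@fits r) w -> reduced (rev w).
  by rewrite /reduced rev_sorted; apply: sub_sorted => x y; rewrite fits_sym.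
move=> rp rv pv; have [w [_ u]] := free_a (rval v).
by rewrite -[p]revK -[v]revK -(u _ (conj (rs _ rv) erefl)) -(u _ (conj (rs _ rp) pv)).
Qed.

Lemma rvalK p : sorted (@fits r) p -> normal_form (rval p) = p.
Proof.
by move=> rp; apply: rval_inj; rewrite ?normal_form_reduced ?rval_normal_form.
Qed.

Lemma size_normal_form_quotient g v : sorted (@fits r) v ->
  size (normal_form (g * (rval v)^-1)%g) = dist (normal_form g) v.
Proof.
move=> rv; have [p [rp pE <-]] := rval_quotient (normal_form_reduced g) rv.
by rewrite -{1}[g]rval_normal_form -pE rvalK.
Qed.

(** Multiplying by a generator changes the length of the normal form by at most
    one. *)
Lemma size_normal_form_prod (w : seq G) :
  (forall s, s \in w -> sym_generators a s) ->
  (size (normal_form (\big[*%g/1%g]_(s <- w) s)) <= size w)%N.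
Proof.
elim/last_ind: w => [|w s IH] Sw.
  by rewrite big_nil -rval_nil rvalK.
rewrite -cats1 big_cat big_seq1 size_cat addn1 /=.
have /IH {IH} : forall s, s \in w -> sym_generators a s.
  by move=> t tw; apply: Sw; rewrite mem_rcons inE tw orbT.
set g := \big[_/_]_(_ <- w) _ => gw.
(* Writing a generator as an inverse makes the product a quotient. *)
have [x ->] : exists x, s = (letter_val a (linv x))^-1%g.
  have [|i [->|->]] := Sw s; first by rewrite mem_rcons mem_head.
  - by exists (i, false); rewrite letter_val_linv invgK.
  - by exists (i, true); rewrite letter_val_linv invgK.
have -> : (letter_val a (linv x))^-1%g = (rval [:: linv x])^-1%g.
  by rewrite rval_cons rval_nil mul1g.
rewrite size_normal_form_quotient//; case: normal_form gw => [|y p] //=.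
by case: ifP => _; [rewrite dist_nilr|]; lia.
Qed.

Lemma has_word_lengthE g k :
  has_word_length (sym_generators a) g k <-> size (normal_form g) = k.
Proof.
have len j h : is_product_of (sym_generators a) j h -> (size (normal_form h) <= j)%N.
  by move=> [w [<- wS <-]]; exact: size_normal_form_prod.
have prod : is_product_of (sym_generators a) (size (normal_form g)) g.
  exists (map (letter_val a) (rev (normal_form g))); split.
  - by rewrite size_map size_rev.
  - by move=> s /mapP[[i []] _ ->]; exists i; [right|left].
  - by rewrite big_map; exact: rval_normal_form.
split=> [[gk kmin]|<-].
  by apply/eqP; rewrite eqn_leq len//= kmin.
by split=> // j; exact: len.
Qed.

Lemma mem_rval_rwords k g :
  (g \in map rval (rwords r k)) = (size (normal_form g) == k).
Proof.
apply/mapP/eqP => [[p]|gk].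
  by rewrite mem_rwords => /andP[rp /eqP <-] ->; rewrite rvalK.
exists (normal_form g); last by rewrite rval_normal_form.
by rewrite mem_rwords normal_form_reduced gk eqxx.
Qed.

Lemma mem_rval_rwords_le n g :
  (g \in map rval (rwords_le r n)) = (size (normal_form g) <= n)%N.
Proof.
apply/mapP/idP => [[p]|gk].
  by rewrite mem_rwords_le => /andP[rp pn] ->; rewrite rvalK.
exists (normal_form g); last by rewrite rval_normal_form.
by rewrite mem_rwords_le normal_form_reduced gk.
Qed.

Lemma word_sphereE n :
  word_sphere (sym_generators a) n = [set` map rval (rwords r n)].
Proof.
apply/seteqP; split=> g /=; rewrite mem_rval_rwords.
  by move/has_word_lengthE => ->.
by move=> /eqP gn; exact/has_word_lengthE.
Qed.

Lemma word_ballE n :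
  word_ball (sym_generators a) n = [set` map rval (rwords_le r n)].
Proof.
apply/seteqP; split=> g /=; rewrite mem_rval_rwords_le.
  by move=> [k kn /has_word_lengthE ->].
by move=> gn; exists (size (normal_form g)) => //; exact/has_word_lengthE.
Qed.

Lemma rval_rwords_uniq n : uniq (map rval (rwords r n)).
Proof.
rewrite map_inj_in_uniq ?filter_uniq ?words_uniq// => p v.
by rewrite !mem_rwords => /andP[rp _] /andP[rv _]; exact: rval_inj.
Qed.

Lemma rval_rwords_le_uniq n : uniq (map rval (rwords_le r n)).
Proof.
rewrite map_inj_in_uniq ?rwords_le_uniq// => p v.
by rewrite !mem_rwords_le => /andP[rp _] /andP[rv _]; exact: rval_inj.
Qed.

End NormalForm.

(** * Sums over spheres of the tree *)

Section SphereSums.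
Context (R : realType) (r : nat).
Notation letter := ('I_r * bool)%type.
Notation q := (2 * r%:R - 1 : R).
Implicit Types (x y z : letter) (p v w : seq letter) (H : seq letter -> R)
  (F : nat -> R).

Lemma sum_wordsS k (P : pred (seq letter)) H :
  \sum_(p <- words r k.+1 | P p) H p =
  \sum_x \sum_(p <- words r k | P (x :: p)) H (x :: p).
Proof.
rewrite big_mkcond /= big_allpairs_dep /= big_enum /=.
rewrite (eq_bigl predT) => [|x]; last by rewrite inE.
by apply: eq_bigr => x _; rewrite -big_mkcond.
Qed.

Definition sum_after k x H := \sum_(p <- words r k | path (@fits r) x p) H p.

Lemma sum_afterS k x H :
  sum_after k.+1 x H = \sum_(z | fits x z) sum_after k z (fun p => H (z :: p)).
Proof.
rewrite /sum_after sum_wordsS [RHS]big_mkcond; apply: eq_bigr => z _ /=.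
by case: ifP => //= _; rewrite big_pred0.
Qed.

Lemma eq_sum_after k x H H' : (forall p, size p = k -> H p = H' p) ->
  sum_after k x H = sum_after k x H'.
Proof.
move=> HH'; rewrite /sum_after big_seq_cond [RHS]big_seq_cond.
by apply: eq_bigr => p /andP[]; rewrite mem_words => /eqP pk _; rewrite HH'.
Qed.

Lemma card_fits x : #|[pred z | fits x z]|%:R = q.
Proof.
rewrite (eq_card (B := predC1 (linv x))); last by move=> z; rewrite !inE fitsE.
have := cardC1 (linv x); rewrite card_prod card_ord card_bool => ->.
case: r x => [[[]]//|r' _]; apply: (addIr 1).
by rewrite subrK -natrM natr1; congr _%:R; lia.
Qed.

Lemma sum_after_cst k x (t : R) : sum_after k x (fun=> t) = q ^+ k * t.
Proof.
elim: k x => [|k IH] x; first by rewrite /sum_after big_cons big_nil /= addr0 expr0 mul1r.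
rewrite sum_afterS (eq_bigr _ (fun z _ => IH z)) sumr_const.
by rewrite -[LHS]mulr_natl card_fits mulrA exprS.
Qed.

(** Sums over a half-tree: the words [v] that may follow the letter [x].  Once the
    common first letter of two words is stripped, what remains of a sum over a
    sphere is such a sum, so these obey a recursion while sums over spheres do
    not. *)
Definition sum_dist_after F k x w := sum_after k x (fun v => F (dist w v)).

Lemma sum_dist_after_nil F k x :
  sum_dist_after F k x [::] = q ^+ k * F k.
Proof.
by rewrite -(sum_after_cst k x); apply: eq_sum_after => p <-; rewrite dist_nil.
Qed.

Lemma sum_dist_after0 F x w : sum_dist_after F 0 x w = F (size w).
Proof. by rewrite /sum_dist_after /sum_after big_cons big_nil /= addr0 dist_nilr. Qed.

Lemma sum_dist_cons_neq F k y z w : y != z ->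
  sum_after k z (fun p => F (dist (y :: w) (z :: p))) =
    q ^+ k * F (size w + k).+2.
Proof.
move=> yz; rewrite -(sum_after_cst k z); apply: eq_sum_after => p pk.
by rewrite /= (negbTE yz) pk.
Qed.

(** Either [v] begins with [y] and the common letter is stripped, or it
    begins with one of the [q - 1] other admissible letters and nothing
    cancels. *)
Lemma sum_dist_afterS F k x y w : fits x y ->
  sum_dist_after F k.+1 x (y :: w) =
    sum_dist_after F k y w + (q - 1) * q ^+ k * F (size w + k).+2.
Proof.
move=> xy; rewrite /sum_dist_after sum_afterS (bigD1 y) //=; congr (_ + _).
  by apply: eq_sum_after => p _; rewrite eqxx.
rewrite (eq_bigr (fun=> q ^+ k * F (size w + k).+2)); last first.
  by move=> z /andP[_ zy]; rewrite sum_dist_cons_neq// eq_sym.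
rewrite sumr_const -[LHS]mulr_natl -(card_fits x) mulrA; congr (_ * _ * _).
apply: (addIr 1); rewrite subrK (cardD1 y [pred z | fits x z]) inE xy natrD addrC.
by congr (_ + _%:R); apply: eq_card => z; rewrite !inE andbC.
Qed.

Lemma sum_rwordsS k H : \sum_(p <- rwords r k.+1) H p =
  \sum_z sum_after k z (fun p => H (z :: p)).
Proof. by rewrite big_filter sum_wordsS. Qed.

Lemma sum_rwords0 H : \sum_(p <- rwords r 0) H p = H [::].
Proof. by rewrite big_seq1. Qed.

Lemma card_letter : #|{: letter}|%:R = q + 1 :> R.
Proof. by rewrite card_prod card_ord card_bool natrM mulrC subrK. Qed.

Lemma size_rwordsS k : (size (rwords r k.+1))%:R = (q + 1) * q ^+ k :> R.
Proof.
rewrite -sum1_size natr_sum sum_rwordsS.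
rewrite (eq_bigr _ (fun z _ => sum_after_cst k z 1)) sumr_const mulr1.
by rewrite -[LHS]mulr_natl card_letter.
Qed.

Lemma size_rwords_le n :
  (size (rwords_le r n))%:R = 1 + (q + 1) * \sum_(0 <= k < n) q ^+ k :> R.
Proof.
rewrite size_flatten /shape -map_comp sumnE big_map natr_sum.
rewrite -[iota 0 n.+1]/(index_iota 0 n.+1) big_nat_recl//= mulr_sumr.
by congr (_ + _); apply: eq_bigr => k _; rewrite size_rwordsS.
Qed.

Lemma sum_dist_rwords_cons F k x w :
  \sum_(v <- rwords r k.+1) F (dist (x :: w) v) =
    sum_dist_after F k x w + q ^+ k.+1 * F (size w + k).+2.
Proof.
rewrite sum_rwordsS (bigD1 x) //=; congr (_ + _).
  by apply: eq_sum_after => p _; rewrite eqxx.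
rewrite (eq_bigr (fun=> q ^+ k * F (size w + k).+2)); last first.
  by move=> z zx; rewrite sum_dist_cons_neq// eq_sym.
rewrite sumr_const -[LHS]mulr_natl exprS -!mulrA; congr (_ * _).
rewrite -(card_fits (linv x)); congr _%:R.
by apply: eq_card => z; rewrite !inE fitsE linvK.
Qed.
End SphereSums.

(** * The tent function and its sphere sums *)

Section Tent.
Context (R : realFieldType).
Implicit Types (L t u : R).

(** The tent with top at [L] and feet at [0] and [2 * L], continued linearly to
    the left of [0]: this makes it odd on [[-L, L]], and the negative values there
    compensate for the points of a sphere that are missing near the root. *)
Definition tent L t : R := Num.min t (Num.max (2 * L - t) 0).

Lemma tent_id L t : t <= L -> tent L t = t.
Proof. by move=> tL; rewrite /tent min_l// le_max; apply/orP; left; lra. Qed.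

Lemma tent_ge0 L t : 0 <= t -> 0 <= tent L t.
Proof. by move=> t0; rewrite /tent le_min t0 le_max lexx orbT. Qed.

Lemma tent_eq0 L t : 0 <= L -> 2 * L <= t -> tent L t = 0.
Proof. by move=> L0 Lt; rewrite /tent max_r ?min_r//; lra. Qed.

(** The tent is midpoint convex except at its top, where averaging over the
    points at distance [m] loses [m] out of [L]. *)
Lemma tent_mid_le L t m n : 0 < L -> 0 <= t -> 0 <= m -> m <= n -> n <= L ->
  2 * (1 - n / L) * tent L t <= tent L (t - m) + tent L (t + m).
Proof.
move=> L0 t0 m0 mn nL.
have e0 : 0 <= n / L by rewrite divr_ge0//; lra.
have e1 : n / L <= 1 by rewrite ler_pdivrMr ?mul1r.
have eL : n = n / L * L by rewrite divfK// gt_eqF.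
move: (n / L) e0 e1 eL => e e0 e1 eL.
rewrite /tent /Num.min /Num.max.
by repeat case: ifP => [|/negbT]; rewrite -?leNgt; nra.
Qed.

End Tent.

Section SphereSumTent.
Context (R : realType) (r : nat) (L s : R).
Notation letter := ('I_r * bool)%type.
Notation q := (2 * r%:R - 1 : R).
Hypotheses (s1 : 1 <= s) (sq : s ^+ 2 = q).
Implicit Types (x y z : letter) (p v w : seq letter).

Definition tent_radial (m : nat) : R := s ^- m * tent L m%:R.

Notation c := ((q - 1) / q).

Let s0 : 0 < s. Proof. exact: lt_le_trans ltr01 s1. Qed.
Let q1 : 1 <= q. Proof. by rewrite -sq expr_ge1// ltW. Qed.

Lemma tent_radial_ge0 m : 0 <= tent_radial m.
Proof. by rewrite mulr_ge0 ?tent_ge0// invr_ge0 exprn_ge0// ltW. Qed.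

(** The value at the root of the level count: the tent is the identity there. *)
Lemma sum_linear_centred (k : nat) :
  \sum_(i < k) (2 * i%:R + 2 - k%:R) = k%:R :> R.
Proof.
rewrite big_split/= sumr_const card_ord -[_ *+ k]mulr_natr.
have -> : \sum_(i < k) (2 * i%:R + 2) = k%:R * (k%:R + 1) :> R.
  elim: k => [|k IH]; first by rewrite big_ord0 mul0r.
  by rewrite big_ord_recr/= IH -natr1; ring.
by ring.
Qed.

(** Far from the root this is the exact count of the points of the half-tree by
    level.  When [k] exceeds the length of [w] the path to the nearest levels goes
    through the root, and there the oddness of the tent makes the formal count
    at most the actual sum. *)
Lemma sum_dist_after_tent_radial_ge k x w : path (@fits r) x w -> k%:R <= L ->
  s ^+ k / s ^+ size w * (tent L ((size w)%:R - k%:R) +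
    c * \sum_(i < k) tent L ((size w)%:R - k%:R + 2 * i%:R + 2)) <=
  sum_dist_after tent_radial k x w.
Proof.
have sU : s != 0 by rewrite gt_eqF.
have q0 : 0 < q by exact: lt_le_trans q1.
have c1 : c <= 1 by rewrite ler_pdivrMr// mul1r gerBl.
elim: w k x => [|y w IH] [|k] x.
- by move=> _ _; rewrite sum_dist_after0 big_ord0 mulr0 addr0 expr0 div1r subr0.
- move=> _ kL; rewrite sum_dist_after_nil /= expr0 divr1 sub0r /tent_radial.
  have -> : q ^+ k.+1 * (s ^- k.+1 * tent L k.+1%:R) = s ^+ k.+1 * k.+1%:R.
    by rewrite tent_id// -sq -exprM mulnC exprM expr2 mulrA mulfK// expf_neq0.
  rewrite ler_pM2l ?exprn_gt0// tent_id; last first.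
    by rewrite (le_trans _ kL)// (le_trans (y := 0)) ?oppr_le0.
  rewrite (eq_bigr (fun i : 'I__ => 2 * i%:R + 2 - k.+1%:R)); last first.
    move=> i _; rewrite -addrA addrC tent_id// (le_trans _ kL)//.
    have : (i.+1%:R : R) <= k.+1%:R by rewrite ler_nat.
    by rewrite -natr1; lra.
  rewrite sum_linear_centred; have := ler0n R k.+1; nra.
- by move=> _ _; rewrite sum_dist_after0 big_ord0 mulr0 addr0 expr0 div1r subr0.
- move=> /= /andP[xy yw] kL; rewrite sum_dist_afterS//.
  have kL' : k%:R <= L by rewrite (le_trans _ kL)// ler_nat.
  apply: le_trans (lerD (IH k y yw kL') (lexx _)).
  rewrite big_ord_recr /= -[(size w).+1%:R]natr1 -[k.+1%:R]natr1.
  rewrite opprD addrACA subrr addr0.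
  have -> : (size w)%:R - k%:R + 2 * k%:R + 2 = (size w + k).+2%:R :> R.
    by rewrite -!natr1 natrD; ring.
  rewrite /tent_radial -sq exprS [s ^+ (size w).+1]exprS.
  set A := \sum_(_ < _) _; set B := tent _ _; set C := tent _ _.
  apply: eq_implies_le.
  rewrite !exprS exprD expr0 mulr1 exprMn.
  have := expf_neq0 k sU; have := expf_neq0 (size w) sU.
  move: (s ^+ k) (s ^+ _) => S1 S2 ? ?; field.
  by apply/and3P; split.
Qed.

(** The levels met by a sphere are symmetric about the level [t] of its centre,
    so pairing opposite levels reduces the claim to [tent_mid_le]. *)
Lemma sum_tent_sym_ge (k : nat) (t n : R) : 0 < L -> 0 <= t -> k%:R + 1 <= n -> n <= L ->
  (2 + c * k%:R) * ((1 - n / L) * tent L t) <=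
  tent L (t - k.+1%:R) + c * \sum_(i < k) tent L (t - k.+1%:R + 2 * i%:R + 2) +
  tent L (t + k.+1%:R).
Proof.
move=> L0 t0 kn nL; have q0 : 0 < q by exact: lt_le_trans q1.
have c0 : 0 <= c by rewrite divr_ge0 ?(ltW q0)// subr_ge0.
have mid m : 0 <= m -> m <= n ->
    2 * (1 - n / L) * tent L t <= tent L (t - m) + tent L (t + m).
  by move=> m0 mn; exact: tent_mid_le.
set b := (1 - _) * _.
have H : k%:R * b <= \sum_(i < k) tent L (t - k.+1%:R + 2 * i%:R + 2).
  rewrite -(ler_pM2l (x := 2))//.
  have E : 2 * \sum_(i < k) tent L (t - k.+1%:R + 2 * i%:R + 2) =
     \sum_(i < k) (tent L (t - (k%:R - 1 - 2 * i%:R)) +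
                   tent L (t + (k%:R - 1 - 2 * i%:R))).
    rewrite mulr_natl mulr2n big_split; congr (_ + _).
      by apply: eq_bigr => i _; congr tent; rewrite -natr1; ring.
    rewrite (reindex_inj rev_ord_inj); apply: eq_bigr => i _; congr tent.
    by rewrite /= natrB// -!natr1; ring.
  rewrite {}E; have -> : 2 * (k%:R * b) = \sum_(i < k) (2 * b).
    by rewrite sumr_const card_ord -[RHS]mulr_natl mulrCA.
  apply: ler_sum => i _; rewrite /b mulrA.
  set m := _ - 2 * _.
  have ik : i%:R + 1 <= k%:R :> R by rewrite natr1 ler_nat.
  have i0 : 0 <= i%:R :> R by [].
  have [m0|m0] := leP 0 m; first by apply: mid => //; rewrite /m in m0 *; lra.
  rewrite [leRHS]addrC; have := mid (- m); rewrite opprK; apply; rewrite /m in m0 *; lra.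
have M : 2 * b <= tent L (t - k.+1%:R) + tent L (t + k.+1%:R).
  by rewrite mulrA; apply: mid; rewrite ?ler0n// -natr1.
by rewrite mulrDl -mulrA [leRHS]addrAC lerD// ler_wpM2l.
Qed.

(** The eigenvalue, on the generalized eigenfunctions [s ^- |g|] at the edge of
    the spectrum, of the sum over the sphere of radius [k]. *)
Definition sphere_eigenvalue (k : nat) : R :=
  if k is k'.+1 then s ^+ k * (2 + c * k'%:R) else 1.

(** The loss factor [1 - n / L] is the same for all radii [k <= n]; this
    uniformity lets the ball be treated by summing over its spheres. *)
Lemma sum_tent_radial_rwords_ge (k n : nat) w : sorted (@fits r) w ->
  0 < L -> (k <= n)%N -> n%:R <= L ->
  sphere_eigenvalue k * (1 - n%:R / L) * tent_radial (size w) <=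
    \sum_(v <- rwords r k) tent_radial (dist w v).
Proof.
have sU : s != 0 by rewrite gt_eqF.
move=> rw L0 kn nL; case: k kn => [|k] kn.
  rewrite sum_rwords0 dist_nilr mul1r ler_piMl ?tent_radial_ge0//.
  by rewrite gerBl divr_ge0// ltW.
case: w rw => [|x w] rw /=.
  have -> : tent_radial 0 = 0 by rewrite /tent_radial tent_id ?mulr0// ltW.
  rewrite mulr0.
  by apply: sumr_ge0 => v _; exact: tent_radial_ge0.
rewrite sum_dist_rwords_cons.
have kL : k%:R <= L by rewrite (le_trans _ nL)// ler_nat ltnW.
apply: le_trans (lerD (sum_dist_after_tent_radial_ge rw kL) (lexx _)).
have := @sum_tent_sym_ge k (size w).+1%:R n%:R L0 (ler0n _ _).
rewrite natr1 ler_nat => /(_ kn nL).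
have -> : (size w).+1%:R - k.+1%:R = (size w)%:R - k%:R :> R.
  by rewrite -!natr1; ring.
have -> : (size w).+1%:R + k.+1%:R = (size w + k).+2%:R :> R.
  by rewrite -!natr1 natrD; ring.
have : 0 < s ^+ k.+1 / s ^+ (size w).+1 by rewrite divr_gt0// exprn_gt0.
move=> /ler_pM2l <-; rewrite /tent_radial -sq => H.
apply: le_trans (le_trans _ H) _; apply: eq_implies_le.
  by rewrite /=; ring.
rewrite /= !exprS exprD expr0 mulr1 exprMn.
have := expf_neq0 k sU; have := expf_neq0 (size w) sU.
move: (s ^+ k) (s ^+ _) => S1 S2 ? ?; field.
by apply/and3P; split.
Qed.

End SphereSumTent.

(** * Transplanting test functions from the group to the space *)

Section Measure.
Context (d : measure_display) (X : measurableType d) (R : realType).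
Context (nu : probability X R).

(** Of the two parts into which a set is split, one has at most half its
    measure. *)
Lemma atomless_small (eps : R) : atomless nu -> 0 < eps ->
  exists A, [/\ measurable A, 0 < fine (nu A) & fine (nu A) <= eps].
Proof.
move=> atom e0.
have halve k : exists A,
    [/\ measurable A, 0 < fine (nu A) & fine (nu A) <= 2^-1 ^+ k].
  elim: k => [|k [A [mA A0 Ak]]].
    by exists setT; split=> //; rewrite probability_setT /= ?ltr01 ?expr0.
  have finE B : measurable B -> nu B = (fine (nu B))%:E.
    by move=> mB; rewrite fineK// fin_num_measure.
  have [|B [mB BA /andP[]]] := atom A mA; first by rewrite (finE A mA) lte_fin.
  rewrite (finE A mA) (finE B mB) !lte_fin => B0 BltA.
  have [Bh|Bh] := leP (fine (nu B)) (2^-1 ^+ k.+1); first by exists B.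
  have mAB : measurable (A `\` B) by exact: measurableD.
  have ABE : fine (nu (A `\` B)) = fine (nu A) - fine (nu B).
    rewrite measureD ?setIidr//; last by rewrite -ge0_fin_numE ?fin_num_measure.
    by rewrite fineB ?fin_num_measure.
  exists (A `\` B); split=> //; rewrite ABE ?subr_gt0//.
  by move: Bh; rewrite exprS; lra.
have [k ek] : exists k, 2^-1 ^+ k <= eps.
  have half1 : `|2^-1 : R| < 1 by rewrite ger0_norm ?invr_ge0//; lra.
  have /cvgrPdist_le /(_ _ e0) [k _ H] := @cvg_geometric R 1 _ half1.
  exists k.
  by have := H k (leqnn k); rewrite /geometric /= sub0r normrN mul1r ger0_norm.
by have [A [mA A0 Ak]] := halve k; exists A; split=> //; exact: le_trans ek.
Qed.

Lemma ae_in_seq (I : eqType) (s : seq I) (P : I -> X -> Prop) :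
  (forall i, \forall x \ae nu, P i x) ->
  \forall x \ae nu, forall i, i \in s -> P i x.
Proof.
move=> HP; elim: s => [|j s IH]; first by apply: aeW.
move: (HP j) IH; apply: filterS2 => x Pj IH i; rewrite inE => /predU1P[->//|].
exact: IH.
Qed.

Lemma measurable_sum_indic (I : Type) (s : seq I) (c : I -> R) (A : I -> set X) :
  (forall i, measurable (A i)) ->
  measurable_fun setT (fun x => \sum_(i <- s) c i * \1_(A i) x : R).
Proof.
by move=> mA; apply: measurable_sum => i; apply: measurable_funM.
Qed.

Lemma integral_sum_indic (I : Type) (s : seq I) (c : I -> R) (A : I -> set X)
    (t : R) : (forall i, 0 <= c i) -> (forall i, measurable (A i)) ->
  (forall i, nu (A i) = t%:E) ->
  (\int[nu]_x (\sum_(i <- s) c i * \1_(A i) x)%:E = ((\sum_(i <- s) c i) * t)%:E)%E.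
Proof.
move=> c0 mA At; under eq_integral do rewrite -sumEFin.
rewrite ge0_integral_sum//.
- rewrite mulr_suml -sumEFin; apply: eq_bigr => i _.
  under eq_integral do rewrite EFinM.
  rewrite ge0_integralZl ?lee_fin//.
    by rewrite integral_indic// setIT EFinM; congr (_ * _)%E; exact: At.
  exact/measurable_EFinP.
- move=> i; apply/measurable_EFinP; exact: measurable_funM.
- by move=> i x _; rewrite lee_fin mulr_ge0.
Qed.

Lemma L2norm_real (u : X -> R) :
  L2norm nu (fun x => (u x)%:C%C) = ((\int[nu]_x (u x ^+ 2)%:E) `^ 2^-1)%E.
Proof.
rewrite /L2norm unlock; congr poweR; apply: eq_integral => x _ /=.
by rewrite expr0n /= addr0 sqrtr_sqr normr_id powR_mulrn// real_normK// num_real.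
Qed.

Lemma sum_seqE (V : nmodType) (K : choiceType) (s : seq K) (F : K -> V) :
  uniq s -> \sum_(g \in [set` s]) F g = \sum_(g <- s) F g.
Proof. by move=> us; rewrite -fsbig_seq. Qed.

Lemma card_seqE (K : choiceType) (s : seq K) :
  uniq s -> #|` fset_set [set` s] |%fset = size s.
Proof.
move=> us; have -> : [set` s] = [set` [fset x in s]%fset].
  by apply/seteqP; split=> x /=; rewrite !inE.
by rewrite set_fsetK card_fseq undup_id.
Qed.

Section Deviation.
Context (G : groupType) (T : G -> X -> X).

Definition mean_over (V : seq G) (u : X -> R) (x : X) : R :=
  (size V)%:R^-1 * \sum_(v <- V) u (T v x).

Lemma average_real (V : seq G) (u : X -> R) x : uniq V ->
  average T [set` V] (fun y => (u y)%:C%C) x = (mean_over V u x)%:C%C.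
Proof.
move=> uV; rewrite /average card_seqE// sum_seqE// /mean_over rmorphM fmorphV.
by rewrite rmorph_nat rmorph_sum.
Qed.

Lemma Cintegral_real (u : X -> R) :
  Cintegral nu (fun x => (u x)%:C%C) = (\int[nu]_x u x)%:C%C.
Proof. by rewrite /Cintegral /= /Rintegral integral0. Qed.

Lemma sup_deviation_real (V : seq G) (u : X -> R) (rho : R) : uniq V ->
  measurable_fun setT u -> (\int[nu]_x (u x ^+ 2)%:E = 1)%E -> 0 <= rho ->
  ((rho ^+ 2)%:E <= \int[nu]_x ((mean_over V u x - \int[nu]_y u y) ^+ 2)%:E)%E ->
  (rho%:E <= sup_deviation nu T [set` V])%E.
Proof.
move=> uV mu u1 rho0 H.
have u1' : L2norm nu (fun x => (u x)%:C%C) = 1%E.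
  by rewrite L2norm_real u1 poweR1r.
apply: (@le_trans _ _ (L2norm nu (fun x => (mean_over V u x - \int[nu]_y u y)%:C%C))).
  rewrite L2norm_real.
  have -> : rho%:E = ((rho ^+ 2)%:E `^ 2^-1)%E.
    by rewrite poweR_EFin powR12_sqrt ?sqr_ge0// sqrtr_sqr ger0_norm.
  apply: gt0_ler_poweR => //; rewrite in_itv /= leey andbT.
    by rewrite lee_fin sqr_ge0.
  by apply: integral_ge0 => x _; rewrite lee_fin sqr_ge0.
apply: ereal_sup_ubound; exists (fun x => (u x)%:C%C).
  split=> //; split=> //=.
  by rewrite u1' ltry.
congr L2norm; apply/funext => x.
by rewrite average_real// Cintegral_real -rmorphB.
Qed.

Hypothesis actT : mp_action nu T.

Section Transplantation.
Variables (f : G -> R) (E V : seq G) (lam : R) (A : set X) (t : R).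
Hypotheses (f0 : forall g, 0 <= f g) (uE : uniq E) (uV : uniq V)
  (fE : forall g, g \notin E -> f g = 0).
Hypotheses (lam0 : 0 <= lam)
  (fV : forall g, lam * f g <= \sum_(v <- V) f (g * v^-1)%g).
Hypotheses (mA : measurable A) (At : nu A = t%:E).

Definition transplant (x : X) : R := \sum_(g <- E) f g * \1_A (T g x).

Lemma measure_preserving_T g : measure_preserving nu (T g).
Proof. by case: actT. Qed.

Lemma measurable_preimage g B : measurable B -> measurable (T g @^-1` B).
Proof.
by move=> mB; rewrite -[_ @^-1` _]setTI; case: (measure_preserving_T g) => _ + _; exact.
Qed.

Lemma nu_preimage g B : measurable B -> nu (T g @^-1` B) = nu B.
Proof. by case: (measure_preserving_T g) => _ _; exact. Qed.

Local Notation Ag g := (T g @^-1` A).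
Local Notation Avg p := (T p.1 @^-1` (T p.2 @^-1` A)).

Lemma measurable_transplant : measurable_fun setT transplant.
Proof.
apply: (measurable_sum_indic E f (A := fun g => Ag g)) => g.
exact: measurable_preimage.
Qed.

Lemma integral_transplant :
  (\int[nu]_x (transplant x)%:E = ((\sum_(g <- E) f g) * t)%:E)%E.
Proof.
apply: (integral_sum_indic E (A := fun g => Ag g)) => // g.
- exact: measurable_preimage.
- by rewrite nu_preimage.
Qed.

Lemma mean_transplantE x : mean_over V transplant x =
  \sum_(p <- [seq (v, g) | v <- V, g <- E]) ((size V)%:R^-1 * f p.2) * \1_(Avg p) x.
Proof.
rewrite /mean_over mulr_sumr big_allpairs; apply: eq_bigr => v _.
by rewrite mulr_sumr; apply: eq_bigr => g _; rewrite mulrA.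
Qed.

Lemma measurable_mean_transplant : measurable_fun setT (mean_over V transplant).
Proof.
rewrite (funext mean_transplantE).
by apply: measurable_sum_indic => p; do 2!apply: measurable_preimage.
Qed.

Lemma mean_transplant_ge0 x : 0 <= mean_over V transplant x.
Proof.
rewrite /mean_over mulr_ge0// ?invr_ge0//.
by do 2!apply: sumr_ge0 => ? _; rewrite mulr_ge0.
Qed.

Lemma integral_mean_transplant : (0 < size V)%N ->
  (\int[nu]_x (mean_over V transplant x)%:E = ((\sum_(g <- E) f g) * t)%:E)%E.
Proof.
move=> V0; under eq_integral do rewrite mean_transplantE.
rewrite (integral_sum_indic _ (t := t)).
- congr (_ * _)%:E; rewrite big_allpairs /= big_const_seq count_predT iter_addr_0.
  by rewrite -mulr_sumr -[LHS]mulr_natl mulrA divff ?mul1r// pnatr_eq0 -lt0n.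
- by move=> p; rewrite mulr_ge0 ?invr_ge0.
- by move=> p; do 2!apply: measurable_preimage.
- by move=> p; rewrite !nu_preimage//; exact: measurable_preimage.
Qed.

(** The change of variables [g |-> g * v^-1]; it is an inequality since the
    translate of the support need not stay in [E]. *)
Lemma sum_shift_le (v : G) (H : G -> R) : (forall g, 0 <= H g) ->
  \sum_(g <- E) f (g * v^-1)%g * H g <= \sum_(g <- E) f g * H (g * v)%g.
Proof.
move=> H0; pose E' := [seq (g * v^-1)%g | g <- E].
have uE' : uniq E' by rewrite map_inj_uniq//; exact: mulIg.
rewrite (eq_bigr (fun g => f (g * v^-1)%g * H (g * v^-1 * v)%g)); last first.
  by move=> g _; rewrite mulgVK.
rewrite -(big_map (fun g => g * v^-1)%g xpredT (fun g => f g * H (g * v)%g)) -/E'.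
rewrite (bigID (mem E)) /= addrC big1 ?add0r => [|g /fE ->]; last by rewrite mul0r.
rewrite -big_filter [leLHS](perm_big [seq g <- E | g \in E']); last first.
  apply: uniq_perm; rewrite ?filter_uniq// => g.
  by rewrite !mem_filter andbC.
rewrite big_filter big_mkcond; apply: ler_sum => g _.
by case: ifP => // _; rewrite mulr_ge0.
Qed.

(** Averaging [transplant] over [V] averages [f] over right translates by
    [V^-1].  The identity [T (g * v) x = T g (T v x)] is needed for finitely many
    pairs only, so it holds for all of them at almost every [x]. *)
Lemma mean_transplant_ge : \forall x \ae nu,
  lam / (size V)%:R * transplant x <= mean_over V transplant x.
Proof.
have : \forall x \ae nu, forall p, p \in [seq (v, g) | v <- V, g <- E] ->
    T (p.2 * p.1)%g x = T p.2 (T p.1 x).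
  by apply: ae_in_seq => -[v g]; case: actT => _ _; exact.
apply: filterS => x Tx; rewrite /mean_over mulrAC mulrC ler_wpM2l ?invr_ge0//.
apply: (@le_trans _ _ (\sum_(v <- V) \sum_(g <- E) f (g * v^-1)%g * \1_A (T g x))).
  rewrite exchange_big /= /transplant mulr_sumr; apply: ler_sum => g _.
  by rewrite -mulr_suml mulrA ler_wpM2r.
rewrite big_seq [leRHS]big_seq; apply: ler_sum => v vV.
apply: le_trans (sum_shift_le v (H := fun g => \1_A (T g x)) _) _ => //.
apply: eq_implies_le.
rewrite /transplant big_seq [RHS]big_seq; apply: eq_bigr => g gE.
by rewrite (Tx (v, g))//; apply/allpairsP; exists (v, g).
Qed.

(** With [h] the transplanted function, [P h] its average and [m] their common
    mean, [(P h - m) ^ 2 + 2 m (P h) >= (P h) ^ 2 >= (lam / |V|) ^ 2 h ^ 2]; all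
    terms are nonnegative, so each can be integrated separately. *)
Lemma sup_deviation_ge_normalized (rho : R) : (0 < size V)%N ->
  (\int[nu]_x (transplant x ^+ 2)%:E = 1)%E -> 0 <= rho ->
  rho ^+ 2 + 2 * ((\sum_(g <- E) f g) * t) ^+ 2 <= (lam / (size V)%:R) ^+ 2 ->
  (rho%:E <= sup_deviation nu T [set` V])%E.
Proof.
move=> V0 h1 rho0 H; apply: (sup_deviation_real uV measurable_transplant h1 rho0).
rewrite /Rintegral integral_transplant /=; set m := _ * t in H *.
have m0 : 0 <= m.
  have : (0 <= m%:E)%E by rewrite -integral_transplant; apply: integral_ge0 => x _;
    rewrite lee_fin sumr_ge0// => g _; rewrite mulr_ge0.
  by rewrite lee_fin.
set b := lam / _ in H.
have b0 : 0 <= b by rewrite divr_ge0.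
have mh2 : measurable_fun setT (fun x => (transplant x ^+ 2)%:E).
  by apply/measurable_EFinP; apply: measurable_funX; exact: measurable_transplant.
have mdev : measurable_fun setT (fun x => ((mean_over V transplant x - m) ^+ 2)%:E).
  apply/measurable_EFinP; apply: measurable_funX; apply: measurable_funB => //.
  exact: measurable_mean_transplant.
have mP : measurable_fun setT (fun x => (mean_over V transplant x)%:E).
  by apply/measurable_EFinP; exact: measurable_mean_transplant.
have : (\int[nu]_x ((b ^+ 2)%:E * (transplant x ^+ 2)%:E) <=
   \int[nu]_x (((mean_over V transplant x - m) ^+ 2)%:E +
      (2 * m)%:E * (mean_over V transplant x)%:E))%E.
  apply: ae_ge0_le_integral => //.
  - by move=> x _; rewrite -EFinM lee_fin mulr_ge0 ?sqr_ge0.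
  - exact: measurable_funeM.
  - by move=> x _; rewrite -EFinM -EFinD lee_fin addr_ge0 ?sqr_ge0//
      mulr_ge0 ?mean_transplant_ge0// mulr_ge0.
  - by apply: emeasurable_funD => //; exact: measurable_funeM.
  - move: mean_transplant_ge; apply: filterS => x; rewrite -/b => bx _.
    rewrite -!EFinM -EFinD lee_fin -exprMn.
    have : 0 <= b * transplant x.
      by rewrite mulr_ge0// sumr_ge0// => g _; rewrite mulr_ge0.
    move: (b * _) (mean_over _ _ _) bx => y P yP y0.
    have -> : (P - m) ^+ 2 + 2 * m * P = P ^+ 2 + m ^+ 2 by ring.
    by rewrite ler_wpDr ?sqr_ge0// lerXn2r// nnegrE ?(le_trans y0).
rewrite ge0_integralZl//; last 2 first.
- by move=> x _; rewrite lee_fin sqr_ge0.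
- by rewrite lee_fin sqr_ge0.
rewrite h1 mule1 ge0_integralD//; last 3 first.
- by move=> x _; rewrite lee_fin sqr_ge0.
- by move=> x _; rewrite -EFinM lee_fin mulr_ge0 ?mean_transplant_ge0// mulr_ge0.
- exact: measurable_funeM.
rewrite ge0_integralZl//; last 2 first.
- by move=> x _; rewrite lee_fin mean_transplant_ge0.
- by rewrite lee_fin mulr_ge0.
rewrite integral_mean_transplant// -/m -EFinM -leeBlDr// => le_b.
apply: le_trans le_b; rewrite -EFinB lee_fin; lra.
Qed.

End Transplantation.

(** The measure [t] of the set [A] is chosen so
    small that the squared mean of the normalized transplanted function, at most
    [t M ^ 2 / (f g0) ^ 2], is negligible. *)
Theorem sup_deviation_ge (f : G -> R) (E V : seq G) (lam : R) (g0 : G) :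
  atomless nu -> (forall g, 0 <= f g) -> 0 < f g0 -> uniq E ->
  (forall g, g \notin E -> f g = 0) -> uniq V -> (0 < size V)%N -> 0 < lam ->
  (forall g, lam * f g <= \sum_(v <- V) f (g * v^-1)%g) ->
  ((lam / (size V)%:R)%:E <= sup_deviation nu T [set` V])%E.
Proof.
move=> atom f0 fg0 uE fE uV V0 lam0 fV.
set b := lam / _; have b0 : 0 < b by rewrite divr_gt0// ltr0n.
apply/lee_addgt0Pr => e e0; pose rho := Num.max 0 (b - e).
have rho0 : 0 <= rho by rewrite le_max lexx.
have rhob : rho < b by rewrite gt_max b0 gtrBl.
suff : (rho%:E <= sup_deviation nu T [set` V])%E.
  move=> rhoS; rewrite -leeBlDr// -EFinB (le_trans _ rhoS)// lee_fin.
  by rewrite le_max lexx orbT.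
have delta0 : 0 < b ^+ 2 - rho ^+ 2 by rewrite subr_gt0 ltrXn2r// nnegrE ltW.
pose M := \sum_(g <- E) f g.
have g0E : g0 \in E.
  by apply: contraTT fg0 => /fE ->; rewrite ltxx.
have fM g : g \in E -> f g <= M.
  move=> gE; rewrite /M (bigD1_seq g)//= lerDl.
  by apply: sumr_ge0.
have M0 : 0 < M by rewrite (lt_le_trans fg0)// fM.
(* The bound is 2 (mean)^2 <= b^2 - rho^2, solved for the measure of A. *)
have [] := @atomless_small ((b ^+ 2 - rho ^+ 2) * f g0 ^+ 2 / (2 * M ^+ 2)) atom.
  by rewrite !divr_gt0 ?mulr_gt0// exprn_gt0.
move=> A [mA]; set t := fine _ => t0 tsmall.
have At : nu A = t%:E by rewrite /t fineK// fin_num_measure.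
pose h := transplant f E A.
have h0 x : 0 <= h x by apply: sumr_ge0 => g _; rewrite mulr_ge0.
have hM x : h x <= M.
  by apply: ler_sum => g _; rewrite ler_piMr// indicE; case: (_ \in _).
have hg0 x : f g0 * \1_(T g0 @^-1` A) x <= h x.
  rewrite /h /transplant (bigD1_seq g0)//= lerDl.
  by apply: sumr_ge0 => g _; rewrite mulr_ge0.
have mh : measurable_fun setT h by exact: measurable_transplant.
have mh2 : measurable_fun setT (fun x => (h x ^+ 2)%:E).
  by apply/measurable_EFinP; exact: measurable_funX.
have I2le : (\int[nu]_x (h x ^+ 2)%:E <= (M ^+ 2)%:E)%E.
  have <- : (\int[nu]_x (cst (M ^+ 2)%:E x) = (M ^+ 2)%:E)%E.
    rewrite integral_cst// -[RHS]mule1; congr (_ * _)%E.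
    exact: probability_setT.
  apply: ge0_le_integral => //.
  - by move=> x _; rewrite lee_fin sqr_ge0.
  - by move=> x _; rewrite lee_fin lerXn2r ?nnegrE ?h0 ?(ltW M0).
have I2ge : ((f g0 ^+ 2 * t)%:E <= \int[nu]_x (h x ^+ 2)%:E)%E.
  have <- : (\int[nu]_x (f g0 ^+ 2 * \1_(T g0 @^-1` A) x)%:E = (f g0 ^+ 2 * t)%:E)%E.
    have := integral_sum_indic [:: tt] (c := fun=> f g0 ^+ 2)
      (A := fun=> T g0 @^-1` A) (t := t).
    rewrite big_seq1 => <- //.
    + by apply: eq_integral => x _; rewrite big_seq1.
    + by move=> _; rewrite sqr_ge0.
    + by move=> _; exact: measurable_preimage.
    + by move=> _; rewrite nu_preimage.
  apply: ge0_le_integral => //.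
  - by move=> x _; rewrite lee_fin mulr_ge0 ?sqr_ge0.
  - apply/measurable_EFinP; apply: measurable_funM => //.
    by apply: measurable_indic; exact: measurable_preimage.
  - move=> x _; rewrite lee_fin.
    apply: (@le_trans _ _ ((f g0 * \1_(T g0 @^-1` A) x) ^+ 2)).
      by rewrite exprMn indicE; case: (_ \in _); rewrite ?expr1n// expr0n.
    by rewrite lerXn2r ?nnegrE ?h0 ?mulr_ge0.
have I2E : (\int[nu]_x (h x ^+ 2)%:E)%E = (fine (\int[nu]_x (h x ^+ 2)%:E))%:E.
  rewrite fineK// ge0_fin_numE; first by rewrite (le_lt_trans I2le)// ltry.
  by apply: integral_ge0 => x _; rewrite lee_fin sqr_ge0.
move: I2ge I2le; rewrite I2E !lee_fin; set I2 := fine _ => I2ge _.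
have I20 : 0 < I2 by rewrite (lt_le_trans _ I2ge)// mulr_gt0// exprn_gt0.
pose k := (Num.sqrt I2)^-1.
have k0 : 0 < k by rewrite invr_gt0 sqrtr_gt0.
have k2 : k ^+ 2 = I2^-1 by rewrite exprVn sqr_sqrtr// ltW.
have transplantk x : transplant (fun g => k * f g) E A x = k * h x.
  by rewrite /h /transplant mulr_sumr; apply: eq_bigr => g _; rewrite mulrA.
apply: (@sup_deviation_ge_normalized (fun g => k * f g) E V lam A t) => //.
- by move=> g; rewrite mulr_ge0// ltW.
- by move=> g /fE ->; rewrite mulr0.
- exact: ltW.
- by move=> g; rewrite mulrCA -mulr_sumr ler_wpM2l// ltW.
- under eq_integral do rewrite transplantk exprMn EFinM.
  rewrite ge0_integralZl//; last 2 first.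
  + by move=> x _; rewrite lee_fin sqr_ge0.
  + by rewrite lee_fin sqr_ge0.
  by rewrite I2E -EFinM k2 mulVf// gt_eqF.
- rewrite -mulr_sumr -/M -/b -lerBrDl -mulrA exprMn k2.
  rewrite mulrCA -ler_pdivlMl ?invr_gt0// invrK -[leRHS]mulrC.
  have : t * (2 * M ^+ 2) <= (b ^+ 2 - rho ^+ 2) * f g0 ^+ 2.
    by rewrite -ler_pdivlMr// mulr_gt0// exprn_gt0.
  move=> H; apply: (@le_trans _ _ ((b ^+ 2 - rho ^+ 2) * (f g0 ^+ 2 * t))).
    rewrite mulrA exprMn; apply: le_trans (ler_wpM2r (ltW t0) H).
    by apply: eq_implies_le; ring.
  by rewrite ler_wpM2l// ltW.
Qed.

End Deviation.
End Measure.

(** * Lower bounds for spheres and balls *)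

Section FreeAction.
Context (R : realType) (d : measure_display) (X : measurableType d).
Context (nu : probability X R) (G : groupType) (r : nat) (a : 'I_r -> G).
Context (T : G -> X -> X).
Hypotheses (r1 : (1 <= r)%N) (atom : atomless nu) (free_a : free_generators a).
Hypothesis actT : mp_action nu T.
Notation q := (2 * r%:R - 1 : R).
Notation s := (Num.sqrt q).

Lemma q_ge1 : 1 <= q.
Proof.
have : 1 <= r%:R :> R by rewrite ler1n.
lra.
Qed.

Lemma s_ge1 : 1 <= s.
Proof. by rewrite -[leLHS]sqrtr1 ler_wsqrtr// q_ge1. Qed.

Lemma s_sqr : s ^+ 2 = q.
Proof. by rewrite sqr_sqrtr// (le_trans ler01 q_ge1). Qed.

(** The limit [L -> oo] in the family of tent functions. *)
Lemma sup_deviation_words_ge (ws : seq (seq ('I_r * bool))) (n : nat) (K : R) :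
  uniq (map (rval a) ws) -> (forall v, v \in ws -> sorted (@fits r) v) ->
  (0 < size ws)%N -> 0 < K ->
  (forall (L : R) w, sorted (@fits r) w -> 0 < L -> n%:R <= L ->
    K * (1 - n%:R / L) * tent_radial L s (size w) <=
      \sum_(v <- ws) tent_radial L s (dist w v)) ->
  ((K / (size ws)%:R)%:E <= sup_deviation nu T [set` map (rval a) ws])%E.
Proof.
move=> uV rws ws0 K0 HK; set b := K / _.
have b0 : 0 < b by rewrite divr_gt0// ltr0n.
apply/lee_addgt0Pr => e e0.
(* L > n keeps the loss factor positive; L >= b n / e makes the loss at most e. *)
pose l := (n + (Num.truncn (b * n%:R / e)).+1)%N.
pose L : R := l%:R.
have Ln : n%:R < L by rewrite ltr_nat /l addnS ltnS leq_addr.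
have L0 : 0 < L by rewrite (le_lt_trans _ Ln).
have Le : b * n%:R / L <= e.
  rewrite ler_pdivrMr// [leRHS]mulrC -ler_pdivrMr//.
  apply: le_trans (ltW (truncnS_gt _)) _.
  by rewrite ler_nat leq_addl.
rewrite -leeBlDr// -EFinB.
have nf := normal_form_reduced free_a.
apply: (@le_trans _ _ (K * (1 - n%:R / L) / (size (map (rval a) ws))%:R)%:E).
  rewrite lee_fin size_map mulrAC -/b mulrBr mulr1 mulrA lerD2l lerN2.
  exact: Le.
have s0 : 0 < s by exact: lt_le_trans ltr01 s_ge1.
pose x0 : 'I_r * bool := (Ordinal r1, false).
apply: (@sup_deviation_ge _ _ _ nu G T actT
  (fun g => tent_radial L s (size (normal_form free_a g)))
  (map (rval a) (rwords_le r (2 * l))) _ _ (rval a [:: x0])) => //.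
- by move=> g; exact: (tent_radial_ge0 _ s_ge1).
- rewrite rvalK//= /tent_radial tent_id ?mulr1 ?invr_gt0 ?exprn_gt0//.
  by rewrite ler_nat /l addnS.
- exact: rval_rwords_le_uniq.
- move=> g; rewrite mem_rval_rwords_le -ltnNge => lg.
  rewrite /tent_radial tent_eq0 ?mulr0 ?(ltW L0)// /L.
  by rewrite -natrM ler_nat ltnW.
- by rewrite size_map.
- by rewrite mulr_gt0// subr_gt0 ltr_pdivrMr// mul1r.
- move=> g; apply: le_trans (HK _ _ (nf g) L0 (ltW Ln)) _.
  rewrite big_map big_seq [leRHS]big_seq; apply: eq_implies_le.
  by apply: eq_bigr => v vws; rewrite size_normal_form_quotient// rws.
Qed.

Lemma sphere_eigenvalue_gt0 k : 0 < sphere_eigenvalue r s k.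
Proof.
have s0 : 0 < s by exact: lt_le_trans ltr01 s_ge1.
have q0 : 0 < q by exact: lt_le_trans ltr01 q_ge1.
case: k => [|k] /=; first exact: ltr01.
rewrite mulr_gt0 ?exprn_gt0// ltr_wpDr// mulr_ge0// divr_ge0 ?(ltW q0)//.
by rewrite subr_ge0 q_ge1.
Qed.

Lemma sum_sphere_eigenvalue n :
  \sum_(k < n.+1) sphere_eigenvalue r s k = s ^+ n * (1 + (1 + 1 / s) * n%:R).
Proof.
have s0 : s != 0 by rewrite gt_eqF// (lt_le_trans ltr01 s_ge1).
have := s_sqr; move: (s) s0 => t t0 tq.
elim: n => [|n IH]; first by rewrite big_ord1 /= mulr0 addr0 mulr1.
rewrite big_ord_recr IH /= -tq -[n.+1%:R]natr1 exprS.
by move: (t ^+ n) => S; field.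
Qed.

Lemma sphere_bound n :
  ((sphere_eigenvalue r s n / (size (rwords r n))%:R)%:E <=
    sup_deviation nu T (word_sphere (sym_generators a) n))%E.
Proof.
rewrite (word_sphereE free_a); apply: (@sup_deviation_words_ge _ n).
- exact: rval_rwords_uniq.
- by move=> v; rewrite mem_rwords => /andP[].
- rewrite -(ltr0n R); case: n => [//|n].
  have q0 := lt_le_trans ltr01 q_ge1.
  by rewrite size_rwordsS mulr_gt0 ?exprn_gt0// addr_gt0.
- exact: sphere_eigenvalue_gt0.
- by move=> L w rw L0 nL; exact: (sum_tent_radial_rwords_ge s_ge1 s_sqr).
Qed.

Lemma ball_bound n :
  (((\sum_(k < n.+1) sphere_eigenvalue r s k) / (size (rwords_le r n))%:R)%:E <=
    sup_deviation nu T (word_ball (sym_generators a) n))%E.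
Proof.
rewrite (word_ballE free_a); apply: (@sup_deviation_words_ge _ n).
- exact: rval_rwords_le_uniq.
- by move=> v; rewrite mem_rwords_le => /andP[].
- have : [::] \in rwords_le r n by rewrite mem_rwords_le.
  by case: rwords_le.
- rewrite big_ord_recl ltr_pwDl//.
  by apply: sumr_ge0 => k _; exact/ltW/sphere_eigenvalue_gt0.
- move=> L w rw L0 nL; rewrite -mulrA mulr_suml big_flatten big_map.
  rewrite -[iota 0 n.+1]/(index_iota 0 n.+1) big_mkord; apply: ler_sum => k _.
  by rewrite mulrA; apply: (sum_tent_radial_rwords_ge s_ge1 s_sqr) => //; rewrite -ltnS.
Qed.

Lemma powR_half n : q `^ (- (n%:R / 2)) = s ^- n.
Proof.
have q0 : 0 <= q by exact: le_trans ler01 q_ge1.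
by rewrite powRN [n%:R / 2]mulrC powRrM powR12_sqrt// powR_mulrn// sqrtr_ge0.
Qed.

Lemma sphere_eigenvalueE n : sphere_eigenvalue r s n / (size (rwords r n))%:R =
  (1 + (q - 1) / (q + 1) * n%:R) * s ^- n.
Proof.
have s0 : 0 < s by exact: lt_le_trans ltr01 s_ge1.
case: n => [|n] /=; first by rewrite mulr0 addr0 expr0 invr1 !mulr1.
rewrite size_rwordsS; have := s_sqr; move: (s) s0 => t t0 tq.
have t1 : t ^+ 2 + 1 != 0 by rewrite gt_eqF// ltr_wpDl// sqr_ge0.
have S0 : t ^+ n != 0 by rewrite expf_neq0// gt_eqF.
rewrite -tq -[n.+1%:R]natr1 exprS exprAC expr2.
move: (t ^+ n) S0 => S S0; field.
by rewrite S0 gt_eqF//= t1.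
Qed.

Lemma geometric_q n : (q - 1) * \sum_(0 <= k < n) q ^+ k = q ^+ n - 1.
Proof. by rewrite big_mkord -subrX1. Qed.

(** Since [(q - 1) (1 + q + ... + q ^ (n - 1)) = q ^ n - 1], the ball has
    [q ^ n + 2 (1 + q + ... + q ^ (n - 1))] points, which is where [c(q, n)] comes
    from. *)
Lemma ball_eigenvalueE n :
  (\sum_(k < n.+1) sphere_eigenvalue r s k) / (size (rwords_le r n))%:R =
  (1 + 2 * q ^- n * \sum_(0 <= k < n) q ^+ k)^-1 *
  (1 + (1 + 1 / s) * n%:R) * s ^- n.
Proof.
have s0 : 0 < s by exact: lt_le_trans ltr01 s_ge1.
have q0 : 0 < q by exact: lt_le_trans ltr01 q_ge1.
rewrite sum_sphere_eigenvalue size_rwords_le.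
have := geometric_q n.
have : 0 <= \sum_(0 <= k < n) q ^+ k by apply: sumr_ge0 => k _; rewrite exprn_ge0 ?ltW.
move: (\sum_(0 <= k < n) _) => S S0 SE.
have -> : 1 + (q + 1) * S = q ^+ n + 2 * S.
  by have -> : (q + 1) * S = (q - 1) * S + 2 * S; [ring | rewrite SE; ring].
have Q0 : 0 < q ^+ n by rewrite exprn_gt0.
have QE : q ^+ n = s ^+ n * s ^+ n by rewrite -exprMn -expr2 s_sqr.
have t0 : 0 < s ^+ n by rewrite exprn_gt0.
move: Q0 QE t0; move: (q ^+ n) (s ^+ n) => Q t Q0 QE t0.
have D0 : Q + 2 * S != 0 by rewrite gt_eqF// ltr_pwDl// mulr_ge0.
move: (1 + (1 + 1/s) * n%:R) => c; rewrite QE in D0 Q0 *; field.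
by rewrite D0 gt_eqF.
Qed.

End FreeAction.

Theorem proposition1p3 (R : realType) (d : measure_display)
    (X : measurableType d) (nu : probability X R) (G : groupType)
    (r : nat) (a : 'I_r -> G) (T : G -> X -> X) :
  (1 <= r)%N ->
  atomless nu ->
  free_generators a ->
  mp_action nu T ->
  forall n : nat,
  let S := sym_generators a in
  let q : R := 2 * r%:R - 1 in
  let c : R := (1 + 2 * q ^- n * \sum_(0 <= k < n) q ^+ k)^-1 in
  (sup_deviation nu T (word_sphere S n) >=
    ((1 + (q - 1) / (q + 1) * n%:R) * q `^ (- (n%:R / 2)))%:E)%E /\
  (sup_deviation nu T (word_ball S n) >=
    (c * (1 + (1 + 1 / Num.sqrt q) * n%:R) * q `^ (- (n%:R / 2)))%:E)%E.
Proof.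
move=> r1 atom free_a actT n S q c; rewrite /c /q powR_half//; split.
- by rewrite -sphere_eigenvalueE//; exact: sphere_bound.
- by rewrite -ball_eigenvalueE//; exact: ball_bound.
Qed.
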